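(* Let $\omega\in\Omega_0\cup\Omega_1$. Then for each $\epsilon>0$, $$\gamma_{\tilde G_\omega}(n)\succeq\exp\left(\frac{n}{\log^{2+\epsilon}(n)}\right).$$
   Context: Let $T_2$ be the infinite binary rooted tree whose vertices are the finite words over $\{0,1\}$ (the root is the empty word, the children of $v$ are $v0$ and $v1$). Let $P$ denote the action at a vertex $v$ that interchanges the two subtrees rooted at $v0$ and $v1$ (sending $v0w\mapsto v1w$ and $v1w\mapsto v0w$), and let $I$ denote the trivial action. A sequence $(a_n)_{n\ge1}$ with $a_n\in\{P,I\}$ is identified with the automorphism of $T_2$ that acts as $a_n$ at the vertex $1^{n-1}0$ for each $n\ge1$ and trivially at all other vertices. Let $a\in\mathrm{Aut}(T_2)$ act as $P$ at the root and trivially at all other vertices, and let $x$ be the automorphism given by the constant sequence $(P,P,P,\dots)$. For $\omega=\omega_1\omega_2\cdots\in\Omega=\{0,1,2\}^{\mathbb N}$ let $b_\omega,c_\omega,d_\omega$ be the automorphisms given by the sequences $(b_n),(c_n),(d_n)$, where $b_n=I$ if $\omega_n=2$ and $b_n=P$ otherwise; $c_n=I$ if $\omega_n=1$ and $c_n=P$ otherwise; $d_n=I$ if $\omega_n=0$ and $d_n=P$ otherwise. The generalized Grigorchuk overgroup $\tilde G_\omega$ is the subgroup of $\mathrm{Aut}(T_2)$ generated by $a,b_\omega,c_\omega,d_\omega,x$. Subsets of $\Omega$: $\Omega_0$ is the set of sequences containing each of $0,1,2$ infinitely often; $\Omega_2$ is the set of eventually constant sequences; $\Omega_1=\Omega\setminus(\Omega_0\cup\Omega_2)$.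 For a group $G$ with finite generating set $S$, $\gamma_{G,S}(n)$ is the number of elements of $G$ that can be written as a product of at most $n$ generators from $S$; write $\gamma_{\tilde G_\omega}$ for $\gamma_{\tilde G_\omega,\tilde S_\omega}$ with $\tilde S_\omega=\{a,b_\omega,c_\omega,d_\omega,x,xb_\omega,xc_\omega,xd_\omega\}$ (the assertion does not depend on the choice of finite generating set). For functions $f,g$, $f\preceq g$ (equivalently $g\succeq f$) means that there are positive constants $A,B$ such that $f(n)\le A\,g(Bn)$ for all sufficiently large $n$; when $g$ is a volume growth function, $B$ is taken to be a positive integer. Here $\log^{2+\epsilon}(n)=(\log n)^{2+\epsilon}$. *)

(* Defs.v *)
From HB Require Import structures.
From mathcomp Require Import all_boot all_order all_algebra finmap.
From mathcomp Require Import all_classical all_reals all_analysis.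

Set Implicit Arguments.
Unset Strict Implicit.
Unset Printing Implicit Defensive.

Import Order.TTheory GRing.Theory Num.Theory.

Local Open Scope classical_set_scope.

(* Vertices are words over {0, 1}, with 0 = false and 1 = true; the first
   letter of a word is the one closest to the root. *)
Notation word := (seq bool).

Definition child (u v : word) : bool :=
  (v == rcons u false) || (v == rcons u true).

Definition is_tree_aut (f : word -> word) : Prop :=
  [/\ bijective f, f [::] = [::] & forall u v, child (f u) (f v) = child u v].

Record tree_aut : Type := TreeAut {
  tree_aut_fun :> word -> word;
  tree_autP : `[< is_tree_aut tree_aut_fun >] }.

HB.instance Definition _ := [isSub for tree_aut_fun].
HB.instance Definition _ := [Choice of tree_aut by <:].

Lemma childP u v : reflect (exists i, v = rcons u i) (child u v).
Proof.
apply: (iffP orP) => [[/eqP->|/eqP->]|[[] ->]]; [by eexists..|right|left];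
  exact: eqxx.
Qed.

Lemma tree_aut_is (f : tree_aut) : is_tree_aut f.
Proof. exact/asboolP/tree_autP. Qed.

Lemma tree_aut_ext (f g : tree_aut) : f =1 g -> f = g.
Proof. by move=> fg; apply/val_inj/funext. Qed.

Lemma is_tree_aut_id : is_tree_aut id.
Proof. by split=> //; exists id. Qed.

Lemma is_tree_aut_comp f g :
  is_tree_aut f -> is_tree_aut g -> is_tree_aut (f \o g).
Proof.
move=> [fb f0 fc] [gb g0 gc]; split; first exact: bij_comp.
  by rewrite /= g0.
by move=> u v; rewrite /= fc gc.
Qed.

Lemma tree_aut_inv_subproof (f : tree_aut) :
  {g | is_tree_aut g & cancel g f}.
Proof.
apply: cid2; have [[g fK gK] f0 fc] := tree_aut_is f.
exists g => //; split; [by exists f | by rewrite -[in LHS]f0 fK |].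
by move=> u v; rewrite -[in RHS](gK u) -[in RHS](gK v) fc.
Qed.

Definition tree_aut_one : tree_aut := TreeAut (asboolT is_tree_aut_id).

Definition tree_aut_mul (f g : tree_aut) : tree_aut :=
  TreeAut (asboolT (is_tree_aut_comp (tree_aut_is f) (tree_aut_is g))).

Definition tree_aut_inv (f : tree_aut) : tree_aut :=
  TreeAut (asboolT (s2valP (tree_aut_inv_subproof f))).

Lemma tree_aut_mulA : associative tree_aut_mul.
Proof. by move=> f g h; apply: tree_aut_ext. Qed.

Lemma tree_aut_mul1 : left_id tree_aut_one tree_aut_mul.
Proof. by move=> f; apply: tree_aut_ext. Qed.

Lemma tree_aut_mulr1 : right_id tree_aut_one tree_aut_mul.
Proof. by move=> f; apply: tree_aut_ext. Qed.

Lemma tree_aut_mulrV :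
  right_inverse tree_aut_one tree_aut_inv tree_aut_mul.
Proof.
move=> f; apply: tree_aut_ext => v /=.
exact: (s2valP' (tree_aut_inv_subproof f)).
Qed.

Lemma tree_aut_mulV : left_inverse tree_aut_one tree_aut_inv tree_aut_mul.
Proof.
move=> f; apply: tree_aut_ext => v /=.
have [/bij_inj finj _ _] := tree_aut_is f; apply: finj.
exact: (s2valP' (tree_aut_inv_subproof f)).
Qed.

HB.instance Definition _ := isGroup.Build tree_aut
  tree_aut_mulA tree_aut_mul1 tree_aut_mulr1 tree_aut_mulV tree_aut_mulrV.

(* A portrait [p : word -> bool] tells which action is performed at each
   vertex: [true] is P (the two subtrees are interchanged) and [false] is I. *)
Fixpoint portrait_fun (p : word -> bool) (w : word) : word :=
  if w is i :: w' then (p [::] (+) i) :: portrait_fun (fun v => p (i :: v)) w'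
  else [::].

Fixpoint portrait_inv (p : word -> bool) (w : word) : word :=
  if w is j :: w' then
    let i := p [::] (+) j in i :: portrait_inv (fun v => p (i :: v)) w'
  else [::].

Lemma portrait_funK p : cancel (portrait_fun p) (portrait_inv p).
Proof. by move=> w; elim: w p => //= i w IHw p; rewrite addKb IHw. Qed.

Lemma portrait_invK p : cancel (portrait_inv p) (portrait_fun p).
Proof. by move=> w; elim: w p => //= i w IHw p; rewrite addKb IHw. Qed.

Lemma portrait_fun_rcons p u i :
  portrait_fun p (rcons u i) = rcons (portrait_fun p u) (p u (+) i).
Proof. by elim: u p => //= j u IHu p; rewrite IHu. Qed.

Lemma portrait_fun_is_tree_aut p : is_tree_aut (portrait_fun p).
Proof.
split=> //.
  by exists (portrait_inv p); [apply: portrait_funK | apply: portrait_invK].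
move=> u v; apply/childP/childP => [[i fv]|[i ->]]; last first.
  by exists (p u (+) i); rewrite portrait_fun_rcons.
exists (p u (+) i); apply: (can_inj (portrait_funK p)).
by rewrite fv portrait_fun_rcons addKb.
Qed.

Definition portrait (p : word -> bool) : tree_aut :=
  TreeAut (asboolT (portrait_fun_is_tree_aut p)).

(* The automorphism identified with a sequence of actions.  Sequences are
   indexed from 0, so that [s n] is the action at the vertex 1^n 0. *)
Definition spinal (s : nat -> bool) : tree_aut :=
  portrait (fun v =>
    (v == rcons (nseq (size v).-1 true) false) && s (size v).-1).

Section Growth.
Variable gT : groupType.

Definition is_subgroup (H : set gT) : Prop :=
  [/\ H 1%g, (forall g h, H g -> H h -> H (g * h)%g)
    & forall g, H g -> H (g^-1)%g].

Definition subgroup_gen (S : set gT) : set gT :=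
  [set g | forall H, is_subgroup H -> S `<=` H -> H g].

Definition word_ball (S : set gT) (n : nat) : set gT :=
  [set g | exists s : seq gT,
     [/\ (size s <= n)%N, (forall h, h \in s -> S h) & g = (\prod_(h <- s) h)%g]].

(* The cardinal is meaningful when [S] is finite: the ball is then finite by
   [finite_word_ball] below. *)
Definition growth (G S : set gT) (n : nat) : nat :=
  #|` fset_set (G `&` word_ball S n)|.

Lemma finite_word_ball (S : set gT) n : finite_set S -> finite_set (word_ball S n).
Proof.
move=> finS; elim: n => [|n IHn].
  apply: (sub_finite_set _ (finite_set1 (1%g : gT))) => g [s [+ _ ->]].
  by case: s => //= _; rewrite big_nil.
apply: (@sub_finite_set _ _
  ([set 1%g] `|` [set (h * k)%g | h in S & k in word_ball S n])); last first.
  by rewrite finite_setU; split=> //; apply: finite_image2.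
move=> g [[|h s] [sz Ss ->]]; first by left; rewrite big_nil.
right; exists h; first by apply: Ss; rewrite inE eqxx.
exists (\prod_(k <- s) k)%g; last by rewrite big_cons.
by exists s; split=> // k ks; apply: Ss; rewrite inE ks orbT.
Qed.

End Growth.

(* The n-th letter (n >= 1) of a sequence is [w n.-1]. *)
Definition Omega : Type := nat -> 'I_3.

Definition Omega0 : set Omega :=
  [set w | forall (i : 'I_3) (N : nat), exists2 n, (N <= n)%N & w n = i].

Definition Omega2 : set Omega :=
  [set w | exists (i : 'I_3) (N : nat), forall n, (N <= n)%N -> w n = i].

Definition Omega1 : set Omega := ~` (Omega0 `|` Omega2).

Definition gen_a : tree_aut := portrait (fun v => v == [::]).
Definition gen_x : tree_aut := spinal (fun=> true).
Definition gen_b (w : Omega) : tree_aut := spinal (fun n => w n != 2 :> nat).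
Definition gen_c (w : Omega) : tree_aut := spinal (fun n => w n != 1 :> nat).
Definition gen_d (w : Omega) : tree_aut := spinal (fun n => w n != 0 :> nat).

Definition overgroup (w : Omega) : set tree_aut :=
  subgroup_gen [set gen_a; gen_b w; gen_c w; gen_d w; gen_x].

Definition overgroup_gens (w : Omega) : set tree_aut :=
  [set gen_a; gen_b w; gen_c w; gen_d w; gen_x;
       (gen_x * gen_b w)%g; (gen_x * gen_c w)%g; (gen_x * gen_d w)%g].

Definition overgroup_growth (w : Omega) : nat -> nat :=
  growth (overgroup w) (overgroup_gens w).

Lemma finite_overgroup_gens w : finite_set (overgroup_gens w).
Proof. by rewrite /overgroup_gens !finite_setU; do !split. Qed.

Lemma subgroup_gen_overgroup_gens w :
  subgroup_gen (overgroup_gens w) = overgroup w.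
Proof.
apply/seteqP; split=> g Gg H sgH SH; apply: Gg => // h; last first.
  by move=> Sh; apply: SH; do 3 left.
have [_ HM _] := sgH.
move=> [[[Sh|->]|->]|->]; first exact: SH.
- by apply: HM; apply: SH; [right | do 3 left; right].
- by apply: HM; apply: SH; [right | do 2 left; right].
- by apply: HM; apply: SH; [right | left; right].
Qed.

(* Since the dominating function is only evaluated at integers, the constant
   [B] is a positive integer. *)
Definition growth_preceq (R : realType) (f g : nat -> R) : Prop :=
  exists (A : R) (B : nat),
    [/\ (0 < A)%R, (0 < B)%N & \forall n \near \oo, (f n <= A * g (B * n)%N)%R].

(* Main.v *)
(* One of b, c, d has a sequence that is not eventually constant; call it s.
   The element t = ax acts on each level K of the tree as a single cycle of
   length 2^K.  Put n = 2^M and consider the products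
     W(J, e) = s^(e_(n-1)) t^(J_(n-1)) ... s^(e_0) t^(J_0)
   with e in {0,1}^n and 0 <= J_j < L_j := 32 M 2^(v_2(j)).  Following the
   vertex 1^K under the factors, a use of s at 1^K leaves in the germ of the
   product a trace that a and x cannot erase, because the sequence of s is not
   eventually constant.  Hence e_i can be read off W(J, e) and the previous
   e_j, unless the walk started at 1^K at time i + 1 returns to 1^K.  As t acts
   freely, a return after d steps has probability at most 1 / L_j over J, for
   each j among these steps; one of them has v_2(j) >= log_2 d - 1, so the
   expected number of returns is at most 1/32.  For a suitable J, half of the
   e then have at most n/16 indices with a return, and recording the e_i at
   these indices recovers e from W(J, e).  So there are at least 2^(3n/8)
   products, of length at most 64 M (M+1) 2^M = O(n log^2 n), and the growth is
   at least exp(c n / log^2 n). *)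

Require Import Defs.
From mathcomp Require Import all_boot all_order all_algebra.
From mathcomp Require Import all_classical all_reals all_analysis.
From mathcomp Require Import zify lra.

Set Implicit Arguments.
Unset Strict Implicit.
Unset Printing Implicit Defensive.

Import Order.TTheory GRing.Theory Num.Theory.

Local Open Scope nat_scope.

(** * Local actions of tree automorphisms *)

Lemma mulgE (g h : tree_aut) v : (g * h)%g v = g (h v).
Proof. by []. Qed.

Lemma tree_aut_inj (g : tree_aut) : injective g.
Proof. by have [/bij_inj] := tree_aut_is g. Qed.

(** The portrait of [g]: [true] exactly when [g] swaps the two subtrees below [v]. *)
Definition activity (g : tree_aut) (v : word) : bool :=
  last false (g (rcons v false)).

Lemma tree_aut_rcons (g : tree_aut) v i :
  g (rcons v i) = rcons (g v) (activity g v (+) i).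
Proof.
have [_ _ gc] := tree_aut_is g.
have child_img j : exists k, g (rcons v j) = rcons (g v) k.
  by apply/childP; rewrite gc; apply/childP; exists j.
rewrite /activity; have [k0 e0] := child_img false.
have [k1 e1] := child_img true.
have : k0 != k1.
  apply/eqP => k01; have /tree_aut_inj : g (rcons v false) = g (rcons v true).
    by rewrite e0 e1 k01.
  by move/rcons_inj.
by rewrite e0 last_rcons; case: i => //; rewrite ?e1 ?e0 ?addbF //;
  case: k0 k1 {e0 e1} => [] [].
Qed.

Lemma size_tree_aut (g : tree_aut) v : size (g v) = size v.
Proof.
elim/last_ind: v => [|v i IHv]; first by have [_ -> _] := tree_aut_is g.
by rewrite tree_aut_rcons !size_rcons IHv.
Qed.

Lemma take_tree_aut (g : tree_aut) k v : take k (g v) = g (take k v).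
Proof.
elim/last_ind: v => [|v i IHv]; first by have [_ -> _] := tree_aut_is g.
rewrite tree_aut_rcons -!cats1 !take_cat size_tree_aut.
case: ltngtP => [//|kv|->].
  have -> : k - size v = (k - (size v).+1).+1 by lia.
  by rewrite /= !cats1 tree_aut_rcons.
by rewrite subnn /= !cats0.
Qed.

Lemma activityM g h v :
  activity (g * h)%g v = activity g (h v) (+) activity h v.
Proof.
rewrite {1}/activity mulgE (tree_aut_rcons h) addbF.
by rewrite tree_aut_rcons last_rcons.
Qed.

Lemma activity_portrait p v : activity (portrait p) v = p v.
Proof.
by rewrite /activity [portrait p _]portrait_fun_rcons last_rcons addbF.
Qed.

(** * The generators [a] and [x], and the powers of t = ax *)

Lemma portrait_fun_ext p q : p =1 q -> portrait_fun p =1 portrait_fun q.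
Proof.
move=> pq v; elim: v p q pq => //= i v IHv p q pq; rewrite pq.
by congr (_ :: _); apply: IHv => u; apply: pq.
Qed.

Lemma portrait_fun0 v : portrait_fun (fun=> false) v = v.
Proof. by elim: v => //= i v ->. Qed.

Lemma gen_a_cons i v : gen_a (i :: v) = ~~ i :: v.
Proof. by rewrite /= (@portrait_fun_ext _ (fun=> false)) // portrait_fun0. Qed.

Lemma spinal_true s v : spinal s (true :: v) = true :: spinal (s \o succn) v.
Proof.
rewrite /=; congr (_ :: _).
by apply: portrait_fun_ext => -[|i u] //=; case: i.
Qed.

Lemma gen_x_false v : gen_x (false :: v) = false :: gen_a v.
Proof.
rewrite /=; congr (_ :: _); apply: portrait_fun_ext => -[|i u] //=.
Qed.

Lemma gen_x_true v : gen_x (true :: v) = true :: gen_x v.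
Proof. exact: spinal_true. Qed.

Lemma spinal_fix s k : spinal s (nseq k true) = nseq k true.
Proof. by elim: k s => // k IHk s; rewrite [nseq _ _]/= spinal_true IHk. Qed.

Lemma gen_aK : (gen_a * gen_a)%g = 1%g.
Proof.
by apply: tree_aut_ext => -[|i v] //; rewrite mulgE !gen_a_cons negbK.
Qed.

Lemma gen_xK : (gen_x * gen_x)%g = 1%g.
Proof.
apply: tree_aut_ext; elim=> // -[] v IHv; rewrite mulgE.
  by rewrite !gen_x_true; congr (_ :: _).
by rewrite !gen_x_false -mulgE gen_aK.
Qed.

Definition rot : tree_aut := (gen_a * gen_x)%g.
Definition rotV : tree_aut := (gen_x * gen_a)%g.

Lemma rotVK : (rotV * rot)%g = 1%g.
Proof.
rewrite /rotV /rot -!mulgA (mulgA gen_a gen_a) gen_aK mul1g; exact: gen_xK.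
Qed.

Lemma rotK : (rot * rotV)%g = 1%g.
Proof.
rewrite /rotV /rot -!mulgA (mulgA gen_x gen_x) gen_xK mul1g; exact: gen_aK.
Qed.

Lemma rotKX j : (rot ^+ j * rotV ^+ j)%g = 1%g.
Proof.
rewrite -expgMn ?rotK ?expg1n // /commute.
by rewrite rotK rotVK.
Qed.

Lemma rot_cons i v :
  rot (i :: v) = ~~ i :: (if i then gen_x v else gen_a v).
Proof. by case: i; rewrite /rot mulgE ?gen_x_true ?gen_x_false gen_a_cons. Qed.

(** As t exchanges the two halves of the tree, two steps compose to ax on one half and to xa on the
    other. *)
Lemma rotX2_cons j i v :
  (rot ^+ j.*2)%g (i :: v) =
  i :: (if i then (rot ^+ j)%g v else (rotV ^+ j)%g v).
Proof.
elim: j => [|j IHj]; first by case: i.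
rewrite doubleS !expgS (mulgE rot) (mulgE rot) IHj.
by case: i {IHj}; rewrite !rot_cons.
Qed.

(** Odd powers change the first letter. An even power passes half its exponent to the subtree, up to
    inversion, which keeps the fixed points. *)
Lemma rotX_fix j v : (rot ^+ j)%g v = v -> 2 ^ size v %| j.
Proof.
elim: v j => [|i v IHv] j; first by rewrite dvd1n.
rewrite -[j]odd_double_half; case: (odd j); rewrite ?add0n ?add1n.
  rewrite expgS mulgE rotX2_cons rot_cons; by case: i.
rewrite rotX2_cons expnS -muln2 mulnC => -[fixv].
rewrite dvdn_pmul2r //; apply: IHv; case: i fixv => // fixv.
by rewrite -[in LHS]fixv -mulgE rotKX.
Qed.

Lemma rotX_free j j' v : j < 2 ^ size v -> j' < 2 ^ size v ->
  (rot ^+ j)%g v = (rot ^+ j')%g v -> j = j'.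
Proof.
wlog le_jj' : j j' / j <= j' => [hw jv j'v e|jv j'v].
  by case/orP: (leq_total j j') => le; [|symmetry]; apply: hw.
rewrite -[in (rot ^+ j')%g](subnKC le_jj') expgnDr mulgE.
move/tree_aut_inj/esym/rotX_fix => dvd; apply/eqP.
rewrite eqn_leq le_jj' -subn_eq0 -leqn0 leqNgt.
by apply/negP => /dvdn_leq/(_ dvd); lia.
Qed.

(** * Germs along the ray of the vertices 1^k *)

Definition ev_const (f : nat -> bool) : Prop :=
  exists c N, forall k, N <= k -> f k = c.

Lemma ev_const_add f g :
  ev_const f -> ev_const g -> ev_const (fun k => f k (+) g k).
Proof.
move=> [c [N fc]] [c' [N' gc]]; exists (c (+) c'), (maxn N N') => k.
by rewrite geq_max => /andP[/fc -> /gc ->].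
Qed.

Definition offray k : word := rcons (nseq k true) false.

Lemma spinal_offray s k : spinal s (offray k) = offray k.
Proof.
by elim: k s => // k IHk s; rewrite [offray _]/= spinal_true IHk.
Qed.

Lemma size_offray k : size (offray k) = k.+1.
Proof. by rewrite /offray size_rcons size_nseq. Qed.

Lemma take_offray k j : j <= k -> take j (offray k) = nseq j true.
Proof.
by move=> jk; rewrite /offray -cats1 takel_cat ?size_nseq // take_nseq.
Qed.

(* A spinal factor of g contributes its sequence to this activity when the walk
   of [offray k] under h and g is at [offray k], and nothing otherwise. *)
Definition tame (g h : tree_aut) : Prop :=
  ev_const (fun k => activity g (h (offray k))).

Lemma tame1 h : tame 1%g h.
Proof. by exists false, 0 => k _; rewrite /activity last_rcons. Qed.

Lemma tameM f g h : tame g h -> tame f (g * h)%g -> tame (f * g)%g h.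
Proof.
move=> tg tf; have [c [N cN]] := ev_const_add tf tg; exists c, N => k /cN <-.
by rewrite activityM.
Qed.

Lemma tame_gen_a h : tame gen_a h.
Proof.
exists false, 0 => k _; rewrite activity_portrait.
by case: (h _) (size_tree_aut h (offray k)) => //; rewrite size_offray.
Qed.

Lemma activity_spinal s (h : tree_aut) k :
  activity (spinal s) (h (offray k)) = (h (offray k) == offray k) && s k.
Proof. by rewrite activity_portrait /= size_tree_aut size_offray. Qed.

Lemma activity_spinal_offray s k : activity (spinal s) (offray k) = s k.
Proof. by rewrite (activity_spinal _ 1%g) eqxx. Qed.

(** If [h] moves some 1^j 0, it fixes no later 1^k 0: otherwise it would fix 1^j and 1^(j+1), hence
    also 1^j 0. So [x] contributes either at every k or at finitely many. *)
Lemma tame_gen_x h : tame gen_x h.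
Proof.
have [ex|nex] := pselect (exists k, h (offray k) != offray k); last first.
  exists true, 0 => k _; rewrite activity_spinal andbT.
  by apply/negPn/negP => hk; apply: nex; exists k.
have [j hj] := ex; exists false, j.+1 => k jk.
rewrite activity_spinal andbT; apply: contraNF hj => /eqP hk.
have e : h (nseq j.+1 true) = nseq j.+1 true.
  by rewrite -(take_offray jk) -take_tree_aut hk.
have ej : h (nseq j true) = nseq j true.
  by have := congr1 (take j) e; rewrite take_tree_aut !take_nseq.
have := e; rewrite -addn1 nseqD cats1 tree_aut_rcons ej => /rcons_inj[].
by rewrite /offray tree_aut_rcons ej addbT addbF => /negbRL ->.
Qed.

(** For k >= K the vertex 1^k 0 lies below 1^K, so [h] moves it. *)
Lemma tame_spinal s (h : tree_aut) K :
  h (nseq K true) != nseq K true -> tame (spinal s) h.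
Proof.
move=> hK; exists false, K => k Kk; rewrite activity_spinal.
apply: contraNF hK => /andP[/eqP hk _].
by rewrite -(take_offray Kk) -take_tree_aut hk.
Qed.

Lemma tame_rotX j h : tame (rot ^+ j)%g h.
Proof.
elim: j h => [|j IHj] h; first exact: tame1.
rewrite expgS; apply: tameM => //; apply: tameM; first exact: tame_gen_x.
exact: tame_gen_a.
Qed.

(** * Walks and their returns to 1^K *)

Section Walk.
Variable r : nat -> bool.
Implicit Types (J : nat -> nat) (e : nat -> bool).

(** The factors of W(J, e) at times a, ..., a + d - 1, the earliest acting first; W(J, e) itself is
    [walk J e 0 n]. *)
Fixpoint walk J e a d : tree_aut :=
  if d is d'.+1 then
    (spinal r ^+ e (a + d')%N * (rot ^+ J (a + d')%N * walk J e a d'))%g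
  else 1%g.

Lemma walk_cat J e a d1 d2 :
  walk J e a (d1 + d2) = (walk J e (a + d1) d2 * walk J e a d1)%g.
Proof.
elim: d2 => [|d2 IHd]; first by rewrite addn0 mul1g.
by rewrite addnS /= IHd !mulgA addnA.
Qed.

Lemma eq_walk J J' e e' a d :
  (forall j, a <= j < a + d -> J j = J' j /\ e j = e' j) ->
  walk J e a d = walk J' e' a d.
Proof.
elim: d => [//|d IHd] eqJe /=; have [|-> ->] := eqJe (a + d); first by lia.
by rewrite IHd // => j aj; apply: eqJe; lia.
Qed.

Lemma tame_walk J e a d K :
  (forall d', 0 < d' <= d -> walk J e a d' (nseq K true) != nseq K true) ->
  tame (walk J e a d) 1%g.
Proof.
elim: d => [|d IHd] noret; first exact: tame1.
have IH := IHd (fun d' d'd => noret d' ltac:(lia)).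
have := noret d.+1 ltac:(lia); rewrite [walk J e a d.+1]/=.
set Q := (rot ^+ _ * _)%g => hQ; apply: tameM.
  by apply: tameM => //; apply: tame_rotX.
rewrite mulg1; case: (e _) hQ => hQ; last exact: tame1.
(* s fixes 1^K, so being off 1^K after s means being off it before s. *)
rewrite expg1 in hQ *; apply: (@tame_spinal _ _ K); apply: contra hQ => /eqP hQ.
by rewrite mulgE hQ spinal_fix.
Qed.

(** Compare activities at 1^k 0: the factor [spinal r] acts first, fixes 1^k 0 and adds [r k]. All
    other contributions are eventually constant in k, so [r] would be as well. *)
Lemma walk_spinal_neq J e e' a d K : ~ ev_const r ->
  (forall d', 0 < d' <= d -> walk J e a d' (nseq K true) != nseq K true) ->
  (forall d', 0 < d' <= d -> walk J e' a d' (nseq K true) != nseq K true) ->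
  walk J e a d <> (walk J e' a d * spinal r)%g.
Proof.
move=> nr noret noret' eqw; apply: nr.
have [c [N cN]] := ev_const_add (tame_walk noret) (tame_walk noret').
exists c, N => k /cN <-; rewrite eqw activityM.
rewrite (spinal_offray r k) activity_spinal_offray.
by rewrite addbC addKb.
Qed.

Lemma walk_split J e a d m : a <= m < a + d ->
  walk J e a d = (walk J e m.+1 (a + d - m.+1) * spinal r ^+ e m *
                  (rot ^+ J m * walk J e a (m - a)))%g.
Proof.
move=> am; have {1}-> : d = (m - a).+1 + (a + d - m.+1) by lia.
rewrite walk_cat [walk _ _ a _.+1]/=.
have -> : a + (m - a).+1 = m.+1 by lia.
by have -> : a + (m - a) = m; [lia | rewrite !mulgA].
Qed.

(** Only the power of t at time [m] differs, and the powers of t below 2^K send a vertex of level K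
    to distinct vertices. *)
Lemma walk_return_uniq J J' e a d m K : a <= m < a + d ->
  (forall j, j != m -> J j = J' j) -> J m < 2 ^ K -> J' m < 2 ^ K ->
  walk J e a d (nseq K true) = nseq K true ->
  walk J' e a d (nseq K true) = nseq K true -> J m = J' m.
Proof.
move=> am eqJ Jm J'm; rewrite !(walk_split _ _ am).
have eqw b k : (m < b) || (b + k <= m) -> walk J e b k = walk J' e b k.
  by move=> bk; apply: eq_walk => j bj; rewrite eqJ //; lia.
rewrite !eqw; [|lia..].
set P := (walk _ _ m.+1 _ * _)%g; set v := nseq K true; set Q := walk _ _ a _.
move=> fixJ fixJ'.
have /tree_aut_inj : P ((rot ^+ J m)%g (Q v)) = P ((rot ^+ J' m)%g (Q v)).
  by rewrite [LHS]fixJ [RHS]fixJ'.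
by apply: rotX_free; rewrite size_tree_aut size_nseq.
Qed.

End Walk.

(** * Counting the jumps that lead to a return *)

Section Extension.
Variables (n : nat) (T : Type) (x0 : T).

Definition ord_ext (f : 'I_n -> T) (j : nat) : T := oapp f x0 (insub j).

Lemma ord_extE f (i : 'I_n) : ord_ext f i = f i.
Proof. by rewrite /ord_ext valK. Qed.

End Extension.

Section Returns.
Variables (r : nat -> bool) (K n : nat) (L : nat -> nat).
Hypothesis L_le : forall j, j < n -> L j <= 2 ^ K.

Local Notation jumps := {ffun 'I_n -> 'I_(2 ^ K)}.
Local Notation switches := {ffun 'I_n -> bool}.

Definition fwalk (J : jumps) (e : switches) : nat -> nat -> tree_aut :=
  walk r (ord_ext 0 (fun i => J i : nat)) (ord_ext false e).

Definition returns (J : jumps) (e : switches) (a d : nat) : bool :=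
  fwalk J e a d (nseq K true) == nseq K true.

Definition bounded_jumps : {set jumps} :=
  [set J : jumps | [forall j, J j < L j]].

Lemma returns_uniq (J J' : jumps) e a d (m : 'I_n) : a <= m < a + d ->
  (forall i, i != m -> J i = J' i) ->
  returns J e a d -> returns J' e a d -> J m = J' m.
Proof.
move=> am eqJ /eqP retJ /eqP retJ'; apply: val_inj.
rewrite /= -[LHS](ord_extE 0 (fun i => J i : nat)).
rewrite -[RHS](ord_extE 0 (fun i => J' i : nat)).
apply: walk_return_uniq am _ _ _ retJ retJ'; rewrite ?ord_extE //.
move=> j jm; rewrite /ord_ext; case: insubP => //= i _ ij.
by rewrite eqJ // -val_eqE /= ij.
Qed.

(** Resetting [J m] to each of its [L m] admissible values is injective on returning tuples, since
    the other jumps leave at most one value of [J m] that returns. *)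
Lemma card_returns e a d (m : 'I_n) : a <= m < a + d ->
  #|[set J in bounded_jumps | returns J e a d]| * L m <= #|bounded_jumps|.
Proof.
move=> am; set A := [set J in _ | _].
pose upd (Jv : jumps * 'I_(L m)) : jumps :=
  [ffun j => if j == m then widen_ord (L_le (ltn_ord m)) Jv.2 else Jv.1 j].
have -> : #|A| * L m = #|finset.setX A [set: 'I_(L m)]|.
  by rewrite finset.cardsX cardsT card_ord.
rewrite -(card_in_imset (f := upd)).
  apply/subset_leq_card/fintype.subsetP => _
    /imsetP[[J v] /finset.setXP[+ _] ->].
  rewrite !inE => /andP[/forallP JL _]; apply/forallP => j; rewrite ffunE.
  by case: eqP => [->/=|_]; [exact: ltn_ord | exact: JL].
move=> [J v] [J' v'] /finset.setXP[+ _] /finset.setXP[+ _] equpd.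
rewrite !inE => /andP[_ retJ] /andP[_ retJ'].
have eqJ i : i != m -> J i = J' i.
  move=> /negbTE im; have := congr1 (fun f : jumps => f i) equpd.
  by rewrite !ffunE im.
congr (_, _).
  apply/ffunP => i; have [->|/eqJ //] := eqVneq i m.
  exact: returns_uniq am eqJ retJ retJ'.
have := congr1 (fun f : jumps => f m) equpd; rewrite !ffunE eqxx.
by move=> /(congr1 val) /= vv; apply: val_inj.
Qed.

End Returns.

(** The block 2^k <= d < 2^(k+1) has 2^k terms, each at most T / (c 2^k), so each of the [M] blocks
    contributes at most T / c. *)
Lemma dyadic_sum c T (f : nat -> nat) M :
  (forall k d, k < M -> 2 ^ k <= d < 2 ^ k.+1 -> f d * (c * 2 ^ k) <= T) ->
  c * (\sum_(1 <= d < 2 ^ M) f d) <= M * T.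
Proof.
elim: M => [|M IHM] fT; first by rewrite big_geq ?muln0.
rewrite (@big_cat_nat _ _ _ (2 ^ M)) ?expn_gt0 ?leq_exp2l //=.
rewrite mulnDr mulSn addnC.
apply: leq_add; last by apply: IHM => k d kM; apply: fT; lia.
rewrite -(@leq_pmul2r (2 ^ M)) ?expn_gt0 // mulnAC mulnC big_distrl /=.
have -> : T * 2 ^ M = \sum_(2 ^ M <= d < 2 ^ M.+1) T.
  by rewrite sum_nat_const_nat mulnC expnS; congr (_ * _); lia.
by rewrite big_nat [leqRHS]big_nat; apply: leq_sum => d dM; apply: fT.
Qed.

Lemma dvdn_pow2_interval k a d : 0 < a -> 2 ^ k <= d ->
  exists2 m, a <= m < a + d & 2 ^ k <= 2 ^ logn 2 m.
Proof.
move=> a0 kd; have k0 : 0 < 2 ^ k by rewrite expn_gt0.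
have := divn_eq (a + d).-1 (2 ^ k); have := ltn_pmod (a + d).-1 k0.
(* The largest multiple of 2^k below a + d. It is nonzero because a > 0, which matters since
   [logn 2 0] is 0. *)
set q := _ %/ _ => h1 h2; exists (q * 2 ^ k); first by lia.
rewrite leq_exp2l // -pfactor_dvdn ?dvdn_mull //; lia.
Qed.

(* A return after d steps, 2^k <= d < 2^(k+1), has probability at most
   1 / (32 M 2^k), so that the expected number of returns is at most 1 / 32. *)
Definition jump_bound (M j : nat) : nat := 32 * M * 2 ^ logn 2 j.

Lemma jump_bound_le M j : j < 2 ^ M -> jump_bound M j <= 2 ^ (32 * M + M).
Proof.
move=> jM; rewrite /jump_bound expnD leq_mul ?(ltnW (ltn_expl _ _)) //.
rewrite leq_exp2l //; have [->|j0] := posnP j; first by rewrite logn0.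
rewrite -(@leq_exp2l 2) //; apply: leq_trans (ltnW jM).
by rewrite dvdn_leq // pfactor_dvdnn.
Qed.

(** * Choice of the jumps and decoding of the switches *)

Section Count.
Variables (r : nat -> bool) (M : nat).
Hypothesis M_gt0 : 0 < M.

Local Notation n := (2 ^ M).
Local Notation K := (32 * M + M).
Local Notation jumps := {ffun 'I_n -> 'I_(2 ^ K)}.
Local Notation switches := {ffun 'I_n -> bool}.
Local Notation F := (bounded_jumps K n (jump_bound M)).

Definition recurrent (J : jumps) (e : switches) (i : nat) : bool :=
  [exists d : 'I_n, [&& 0 < d, i.+1 + d <= n & returns r J e i.+1 d]].

Lemma card_sum (T : finType) (A : {set T}) (P : pred T) :
  #|[set x in A | P x]| = \sum_(x in A) P x.
Proof.
rewrite -sum1_card big_mkcond [RHS]big_mkcond /=; apply: eq_bigr => x _.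
by rewrite inE; case: (x \in A) => //=; case: (P x).
Qed.

(** Union bound over the return time [d]: for 2^k <= d < 2^(k+1), some step [m] among the [d] steps
    is divisible by 2^k and bounds the term. *)
Lemma card_recurrent e i : 32 * #|[set J in F | recurrent J e i]| <= #|F|.
Proof.
pose f d := #|[set J in F | (i.+1 + d <= n) && returns r J e i.+1 d]|.
rewrite -(@leq_pmul2l M) // mulnA (mulnC M).
apply: (leq_trans _ (@dyadic_sum (32 * M) #|F| f M _)); last first.
  move=> k d kM /andP[kd dk]; have [idn|idn] := leqP (i.+1 + d) n; last first.
    by rewrite /f (ltn_geF idn) eq_card0 // => J; rewrite !inE andbF.
  have [m /andP[im md] km] := dvdn_pow2_interval (ltn0Sn i) kd.
  have mn : m < n by lia.
  have am : i.+1 <= Ordinal mn < i.+1 + d by rewrite im md.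
  apply: leq_trans (card_returns r (@jump_bound_le M) e am).
  by rewrite leq_mul //= ?leq_mul // /f idn.
rewrite leq_mul2l; apply/orP; right; rewrite card_sum.
under [leqRHS]eq_bigr do rewrite /f card_sum.
rewrite exchange_big /=; apply: leq_sum => J _.
case rec: (recurrent J e i) => //.
have /existsP[d /and3P[d0 idn ret]] := rec.
rewrite (bigD1_seq (d : nat)) ?iota_uniq ?mem_index_iota ?d0 ?ltn_ord //=.
by rewrite idn ret.
Qed.

(** Average over [J] in [F], after exchanging the sums over [J], [e] and [i]. *)
Lemma exists_jumps : exists2 J : jumps, J \in F &
  32 * (\sum_(e : switches) \sum_(i < n) recurrent J e i) <= n * 2 ^ n.
Proof.
have F_gt0 : 0 < #|F|.
  apply/card_gt0P; exists [ffun=> Ordinal (expn_gt0 2 K)].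
  rewrite inE; apply/forallP => j; rewrite ffunE /= /jump_bound.
  by rewrite !muln_gt0 M_gt0 expn_gt0.
set X := fun J : jumps => \sum_(e : switches) \sum_(i < n) recurrent J e i.
have [[J JF hJ]|hJ] := pselect (exists2 J, J \in F & 32 * X J <= n * 2 ^ n).
  by exists J.
have : \sum_(J in F) (n * 2 ^ n).+1 <= \sum_(J in F) 32 * X J.
  apply: leq_sum => J JF; rewrite ltnNge; apply/negP => XJ.
  by apply: hJ; exists J.
rewrite sum_nat_const -big_distrr /= /X exchange_big /=.
have : 32 * (\sum_(e : switches) \sum_(J in F) \sum_(i < n) recurrent J e i)
    <= \sum_(e : switches) \sum_(i < n) #|F|.
  rewrite big_distrr /=; apply: leq_sum => e _.
  rewrite exchange_big big_distrr /=.
  by apply: leq_sum => i _; rewrite -card_sum card_recurrent.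
rewrite !sum_nat_const card_ffun card_bool !card_ord => hle hge; exfalso.
have := leq_trans hge hle; rewrite mulnS mulnA (mulnC #|F|) mulnAC.
by rewrite (mulnC n) -mulnA leqNgt -[ltnLHS]add0n ltn_add2r F_gt0.
Qed.

Definition few_recurrent (J : jumps) (e : switches) : bool :=
  16 * (\sum_(i < n) recurrent J e i) <= n.

(** Markov's inequality: the mean number of recurrent indices is at most n/32, so at most half of
    the [e] exceed n/16. *)
Lemma exists_jumps_few : exists2 J : jumps, J \in F &
  2 ^ n <= 2 * #|[set e | few_recurrent J e]|.
Proof.
have n_gt0 : 0 < n by rewrite expn_gt0.
have [J JF hJ] := exists_jumps; exists J => //.
set E := [set e | _]; have := cardsC E; rewrite card_ffun card_bool card_ord.
suff : 2 * #|~: E| <= 2 ^ n by lia.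
rewrite -(@leq_pmul2l n) // (leq_trans _ hJ) // -sum1_card !big_distrr /=.
rewrite [leqRHS](bigID [in ~: E]) /= (leq_trans _ (leq_addr _ _)) //.
apply: leq_sum => e; rewrite !inE /few_recurrent -ltnNge.
by move: (\sum_(i < n) recurrent J e i) => S; lia.
Qed.

Definition return_code (J : jumps) (e : switches) :
  {ffun 'I_n -> option bool} :=
  [ffun i : 'I_n => if recurrent J e i then Some (e i) else None].

Definition walk_end (J : jumps) (e : switches) : tree_aut := fwalk r J e 0 n.

(** At the first index [i] where [e] and [e'] differ, equal codes exclude a return for both. *)
Lemma walk_end_return_code_inj (J : jumps) (e e' : switches) : ~ ev_const r ->
  walk_end J e = walk_end J e' -> return_code J e = return_code J e' -> e = e'.
Proof.
move=> nr eqW eqC; apply/eqP; apply: contraT => ne; exfalso.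
have [i0 ei0] : exists i, e i != e' i.
  by apply/existsP; apply: contraR ne; rewrite negb_exists => /forallP eq_ee';
  apply/eqP/ffunP => i; apply/eqP/negPn.
have [i ei min_i] := @arg_minnP _ i0 (fun i => e i != e' i) (@nat_of_ord n) ei0.
have eq_e (j : nat) : j < i -> ord_ext false e j = ord_ext false e' j.
  move=> ji; rewrite /ord_ext; case: insubP => //= o _ oj; apply/eqP/negPn/negP.
  by move/min_i; rewrite oj leqNgt ji.
have /ffunP/(_ i) := eqC; rewrite !ffunE.
case rec: (recurrent J e i); case rec': (recurrent J e' i) => //.
  by move=> [ee']; rewrite ee' eqxx in ei.
move=> _.
have noret (e1 : switches) : recurrent J e1 i = false ->
    forall d', 0 < d' <= n - i.+1 ->
    fwalk r J e1 i.+1 d' (nseq K true) != nseq K true.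
  move=> nrec d' d'n; apply/negP => ret; suff: recurrent J e1 i by rewrite nrec.
  have d'_lt : d' < n by have := ltn_ord i; lia.
  rewrite /recurrent; apply/existsP; exists (Ordinal d'_lt).
  rewrite /= /returns ret.
  by have := ltn_ord i; lia.
have in_n : 0 <= i < 0 + n by rewrite ltn_ord.
move: eqW; rewrite /walk_end /fwalk !(walk_split _ _ _ in_n) !add0n !ord_extE.
rewrite [walk _ _ (ord_ext false e) 0 _](@eq_walk _ _
  (ord_ext 0 (fun i => J i : nat)) _ (ord_ext false e')); last first.
  by move=> j /andP[_ ji]; rewrite eq_e //; lia.
(* Cancelling the common initial part leaves two walks without returns that differ by one factor
   s. *)
move/mulIg; move: ei (noret e rec) (noret e' rec').
by case: (e i) (e' i) => [] [] //= _ h h'; rewrite ?expg1 ?mulg1 => eqw;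
  [apply: (walk_spinal_neq nr h' h) | apply: (walk_spinal_neq nr h h')].
Qed.

End Count.

(** * Counting the products *)

Lemma card_sparse_codes n m :
  #|[set c : {ffun 'I_n -> option bool} | \sum_(i < n) (c i != None) <= m]|
    * 8 ^ (n - m) <= 10 ^ n.
Proof.
(* With these weights every letter has total weight 10, while a sparse code has
   weight at least 8^(n - m). *)
pose wt (o : option bool) := 8 ^ (o == None).
have sum_wt : \sum_o wt o = 10.
  rewrite (bigD1 None) //= (bigD1 (Some true)) //= (bigD1 (Some false)) //=.
  by rewrite big1 // => -[[]|].
have -> : 10 ^ n = \sum_(c : {ffun 'I_n -> option bool}) \prod_i wt (c i).
  by rewrite -(bigA_distr_bigA (fun=> wt)) /= prod_nat_const card_ord sum_wt.
rewrite -sum1_card big_distrl /= [leqRHS](bigID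
  [in [set c : {ffun 'I_n -> option bool} |
       \sum_(i < n) (c i != None) <= m]]) /= (leq_trans _ (leq_addr _ _)) //.
apply: leq_sum => c; rewrite inE mul1n => cm; rewrite -expn_sum leq_exp2l //.
rewrite leq_subLR (leq_trans _ (leq_add cm (leqnn _))) // -big_split /=.
rewrite -[X in X <= _]card_ord -sum1_card; apply: leq_sum => i _.
by case: eqP.
Qed.

(** With n = 16 m, at least 2^(16 m - 1) switches are determined by their product and one of at most
    10^(16 m) / 8^(15 m) codes. As 10^16 <= 2^54, at least 2^(7 m - 1) products result. *)
Lemma many_walks r M : 4 <= M -> ~ ev_const r ->
  exists (J : nat -> nat) (S : seq tree_aut),
  [/\ forall j, j < 2 ^ M -> J j < jump_bound M j, uniq S,
      2 ^ (6 * 2 ^ (M - 4)) <= size S &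
      forall g, g \in S -> exists e, g = walk r J e 0 (2 ^ M)].
Proof.
move=> M4 nr; have M_gt0 : 0 < M by lia.
have [J JF manyE] := exists_jumps_few r M_gt0.
set E := [set e | _] in manyE.
exists (ord_ext 0 (fun i => J i : nat)).
exists (undup [seq walk_end r J e | e <- enum E]).
split.
- move: JF; rewrite inE => /forallP JF j jM.
  by rewrite (ord_extE 0 (fun i => J i : nat) (Ordinal jM)); apply: JF.
- exact: undup_uniq.
- set m := 2 ^ (M - 4); have nm : 2 ^ M = 16 * m by rewrite -(expnD 2 4) subnKC.
  set S := undup _.
  pose C := [set c : {ffun 'I_(2 ^ M) -> option bool} |
             \sum_(i < 2 ^ M) (c i != None) <= m].
  have codeE e : e \in E -> return_code r J e \in C.
    rewrite !inE /few_recurrent [X in _ <= X -> _]nm leq_pmul2l // => eE.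
    by rewrite (leq_trans _ eE) // leq_sum // => i _; rewrite ffunE; case: ifP.
  have leE : #|E| <= size S * #|C|.
    rewrite !cardE -(size_allpairs pair).
    rewrite -(size_map (fun e => (walk_end r J e, return_code r J e))).
    apply: uniq_leq_size => [|_ /mapP[e eE ->]].
      rewrite map_inj_uniq ?enum_uniq // => e e' [].
      exact: walk_end_return_code_inj.
    apply: allpairs_f; last by rewrite mem_enum codeE // -mem_enum.
    by rewrite mem_undup; apply: map_f.
  have m_gt0 : 0 < m by rewrite expn_gt0.
  have := card_sparse_codes (2 ^ M) m; rewrite -/C.
  have -> : 2 ^ M - m = 15 * m by lia.
  rewrite [X in _ <= 10 ^ X -> _]nm => leC.
  rewrite [X in 2 ^ X <= _]nm in manyE.
  rewrite -(@leq_pmul2r (2 * 10 ^ (16 * m))) ?muln_gt0 ?expn_gt0 //.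
  have h1 : 2 ^ (16 * m) * 8 ^ (15 * m) <= 2 * size S * 10 ^ (16 * m).
    apply: leq_trans (_ : 2 * (size S * #|C|) * 8 ^ (15 * m) <= _).
      by rewrite leq_mul2r (leq_trans manyE) ?orbT // leq_mul2l leE.
    by rewrite -!mulnA !leq_mul2l leC !orbT.
  rewrite (mulnCA (size S)) [leqRHS]mulnA (leq_trans _ h1) //.
  have -> : 2 ^ (16 * m) * 8 ^ (15 * m) = 2 ^ (7 * m) * (2 ^ 54) ^ m.
    rewrite -[8]/(2 ^ 3) -!expnM -!expnD; congr (2 ^ _); lia.
  have m7 : (6 * m).+1 <= 7 * m by lia.
  rewrite mulnA -expnSr (expnM 10); apply: leq_mul; first by rewrite leq_exp2l.
  (* From 10 <= 2^4 and 10^3 <= 2^10. *)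
  have ten16 : 10 ^ 16 <= 2 ^ 54.
    rewrite -[16]/(1 + 3 * 5) -[54]/(4 + 10 * 5) !expnD !(expnM _ _ 5).
    by apply: leq_mul; [|rewrite leq_exp2r].
  by rewrite leq_exp2r; [exact: ten16|].
- move=> g; rewrite mem_undup => /mapP[e _ ->]; by exists (ord_ext false e).
Qed.

(** * Word lengths and balls *)

Lemma sum_double n (f : nat -> nat) :
  \sum_(j < n.*2) f j = \sum_(j < n) (f j.*2 + f j.*2.+1).
Proof.
elim: n => [|n IHn]; first by rewrite !big_ord0.
by rewrite doubleS !big_ord_recr /= IHn addnA.
Qed.

(** The even terms sum to at most twice the sum for the previous [M], and every odd term is 1. *)
Lemma sum_pow2_logn M : \sum_(j < 2 ^ M) 2 ^ logn 2 j <= M.+1 * 2 ^ M.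
Proof.
elim: M => [|M IHM]; first by rewrite big_ord1.
rewrite expnS mul2n (sum_double _ (fun j => 2 ^ logn 2 j)) big_split /=.
have -> : M.+2 * (2 ^ M).*2 = 2 * (M.+1 * 2 ^ M) + 2 ^ M * 2 by lia.
apply: leq_add.
  apply: leq_trans (_ : 2 * (\sum_(j < 2 ^ M) 2 ^ logn 2 j) <= _).
    rewrite big_distrr /= leq_sum // => j _; rewrite -expnS leq_exp2l // -mul2n.
    by have [->|j0] := posnP j; rewrite ?muln0 ?logn0 // lognM.
  by rewrite leq_mul2l.
rewrite (eq_bigr (fun=> 1)) => [|j _].
  by rewrite sum_nat_const card_ord muln1 leq_pmulr.
by rewrite logn_coprime // coprime2n /= odd_double.
Qed.

Section Balls.
Variables (gT : groupType) (S : set gT).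

Lemma word_ball1 n : word_ball S n 1%g.
Proof. by exists [::]; split=> //; rewrite big_nil. Qed.

Lemma word_ball_gen g : S g -> word_ball S 1 g.
Proof.
by move=> Sg; exists [:: g]; split=> [|h|]; rewrite ?big_seq1 // inE => /eqP->.
Qed.

Lemma word_ball_le m n g : m <= n -> word_ball S m g -> word_ball S n g.
Proof.
by move=> mn [s [sm Ss ->]]; exists s; split=> //; apply: leq_trans mn.
Qed.

Lemma word_ballM m n g h :
  word_ball S m g -> word_ball S n h -> word_ball S (m + n) (g * h)%g.
Proof.
move=> [s [sm Ss ->]] [t [tn St ->]]; exists (s ++ t); split.
- by rewrite size_cat leq_add.
- by move=> k; rewrite mem_cat => /orP[/Ss|/St].
- by rewrite big_cat.
Qed.

Lemma word_ballX m n g : word_ball S m g -> word_ball S (m * n) (g ^+ n)%g.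
Proof.
move=> Sg; elim: n => [|n IHn]; first exact: word_ball1.
by rewrite mulnS expgS; apply: word_ballM.
Qed.

Lemma word_ball_subgroup n : (word_ball S n `<=` subgroup_gen S)%classic.
Proof.
move=> _ [s [_ Ss ->]] H [H1 HM _] SH.
rewrite big_seq; apply: (big_rec H) => // h x hs Hx.
by apply: HM => //; apply/SH/Ss.
Qed.

End Balls.

Lemma word_ball_walk (S : set tree_aut) r (J : nat -> nat) e d :
  S gen_a -> S gen_x -> S (spinal r) ->
  word_ball S (\sum_(j < d) (2 * J j).+1) (walk r J e 0 d).
Proof.
move=> Sa Sx Sr; elim: d => [|d IHd]; first exact: word_ball1.
rewrite big_ord_recr /= addnC add0n -add1n -addnA; apply: word_ballM.
  by case: (e d); [rewrite expg1; apply: word_ball_gen | apply: word_ball1].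
apply: word_ballM => //; apply: word_ballX.
exact: (word_ballM (word_ball_gen Sa) (word_ball_gen Sx)).
Qed.

Lemma growth_ge (gT : groupType) (S : set gT) n (s : seq gT) :
  finite_set S -> uniq s -> (forall g, g \in s -> word_ball S n g) ->
  size s <= growth (subgroup_gen S) S n.
Proof.
move=> finS us sS; apply: uniq_leq_size => // g gs.
have fin : finite_set (subgroup_gen S `&` word_ball S n)%classic.
  by apply: sub_finite_set (finite_word_ball n finS); apply: subIset; right.
rewrite in_fset_set // inE; split; last exact: sS.
exact: word_ball_subgroup (sS _ gs).
Qed.

Lemma overgroup_growth_ge (w : Omega) r M n :
  overgroup_gens w (spinal r) -> ~ ev_const r -> 4 <= M ->
  64 * M * M.+1 * 2 ^ M <= n -> 2 ^ (6 * 2 ^ (M - 4)) <= overgroup_growth w n.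
Proof.
move=> Sr nr M4 Mn; have [J [S [JL uS sizeS SW]]] := many_walks M4 nr.
apply: (leq_trans sizeS).
rewrite /overgroup_growth -subgroup_gen_overgroup_gens.
apply: growth_ge => // [|g /SW[e ->]]; first exact: finite_overgroup_gens.
have Sa : overgroup_gens w gen_a by do 7 left.
have Sx : overgroup_gens w gen_x by do 3 left; right.
apply: word_ball_le (word_ball_walk J e (2 ^ M) Sa Sx Sr).
apply: leq_trans Mn.
apply: leq_trans (_ : \sum_(j < 2 ^ M) 2 * jump_bound M j <= _).
  (* The strict bound on [J j] leaves room for the generator s. *)
  by apply: leq_sum => j _; have := JL j (ltn_ord j); lia.
rewrite /jump_bound -big_distrr -big_distrr /= mulnA -mulnA.
have -> : 64 * M * M.+1 * 2 ^ M = 2 * (32 * M) * (M.+1 * 2 ^ M) by lia.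
by rewrite mulnA leq_mul2l sum_pow2_logn orbT.
Qed.

(** * Choice of s and of the scale *)

(** If the sequences of b, c and d were all eventually constant, either one letter would eventually
    fill [w] or all three would eventually vanish from it. *)
Lemma not_ev_const_gen (w : Omega) : ~ Omega2 w ->
  exists2 r, overgroup_gens w (spinal r) & ~ ev_const r.
Proof.
move=> nw.
have [[i nr]|allr] := pselect (exists i : 'I_3, ~ ev_const (fun n => w n != i)).
  exists (fun n => w n != i :> nat) => //.
  by move: i {nr} => [[|[|[|//]]] ?];
    [do 4 left | do 5 left | do 6 left]; right.
case: nw; have [[i [N wi]]|nconst] :=
  pselect (exists i N, forall k, N <= k -> w k = i); first by exists i, N.
have ev (i : 'I_3) : exists N, forall k, N <= k -> w k != i.
  have [] := pselect (ev_const (fun n => w n != i)) => [|nr]; last first.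
    by case: allr; exists i.
  case=> -[] [N wN]; first by exists N.
  by case: nconst; exists i, N => k /wN/negbFE/eqP.
have [N wN] := boolp.choice ev.
have := wN (w (\max_i N i)) (\max_i N i); rewrite eqxx => abs.
by suff: false by []; apply: abs; apply: leq_bigmax.
Qed.

(** Take the largest [M] that fits; the threshold on [n] is the case M = 4. *)
Lemma scale_exists n : 64 * 4 * 5 * 2 ^ 4 <= n -> exists M,
  [/\ 4 <= M, 64 * M * M.+1 * 2 ^ M <= n & n < 64 * M.+1 * M.+2 * 2 ^ M.+1].
Proof.
move=> n0; pose P M := (64 * M * M.+1 * 2 ^ M <= n).
have P4 : P 4 by [].
have Pn M : P M -> M <= n.
  by apply: leq_trans; have := expn_gt0 2 M; nia.
have [M PM maxM] := ex_maxnP (ex_intro P 4 P4) Pn.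
exists M; split=> //; first exact: maxM.
by rewrite ltnNge; apply/negP => /maxM; rewrite ltnn.
Qed.

(** * Real estimates and conclusion *)

Local Open Scope classical_set_scope.
Local Open Scope ring_scope.

Lemma ln2_ge_half (R : realType) : 2^-1 <= ln (2 : R).
Proof.
rewrite -lerN2 -lnV ?posrE //; have := @le_ln1Dx R (- 2^-1).
by have -> : 1 + - 2^-1 = 2^-1 :> R; [lra | apply; lra].
Qed.

(** As ln 2 >= 1/2, e is at most 4. *)
Lemma expR_le_pow2 (R : realType) (k : nat) (y : R) :
  y <= k%:R -> expR y <= (2 ^ (2 * k))%N%:R.
Proof.
move=> yk; have ln2 := ln2_ge_half R.
rewrite -ler_ln ?posrE ?expR_gt0 ?ltr0n ?expn_gt0 // expRK natrX lnXn //.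
rewrite -(mulr_natl (ln _)) natrM mulrAC; apply: le_trans yk _.
rewrite ler_peMl // ; lra.
Qed.

(** With l = ln n >= M/2 and m = 2^(M-4), one has n <= 2^13 M^2 m <= 2^15 l^2 m, and l^eps absorbs
    2^15. *)
Lemma div_ln_powR_le (R : realType) (eps : R) (n M : nat) : (4 <= M)%N ->
  (64 * M * M.+1 * 2 ^ M <= n)%N -> (n < 64 * M.+1 * M.+2 * 2 ^ M.+1)%N ->
  2 ^+ 15 <= (ln n%:R) `^ eps ->
  n%:R / (ln n%:R) `^ (2 + eps) <= (3 * 2 ^ (M - 4))%N%:R :> R.
Proof.
move=> M4 Mn nM; set l := ln n%:R => leps.
have lM : M%:R / 2 <= l.
  have n2M : (2 ^ M <= n)%N.
    by apply: leq_trans Mn; rewrite leq_pmull // !muln_gt0 /=; lia.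
  apply: le_trans (_ : ln ((2 ^ M)%N%:R : R) <= _); last first.
    rewrite ler_ln ?posrE ?ltr0n ?expn_gt0 ?ler_nat //.
    by rewrite (leq_trans _ n2M) ?expn_gt0.
  by rewrite natrX lnXn // -(mulr_natl (ln _)) ler_wpM2l ?ln2_ge_half.
have l_gt0 : 0 < l by apply: lt_le_trans lM; rewrite divr_gt0 // ltr0n; lia.
rewrite powRD; last by rewrite (gt_eqF l_gt0) implybT.
rewrite ler_pdivrMr ?mulr_gt0 ?powR_gt0 //.
rewrite -[2]/(2%:R) powR_mulrn ?(ltW l_gt0) //.
set m := (2 ^ (M - 4))%N.
have nm : (n <= 2 ^ 13 * (M * M) * m)%N.
  apply: (leq_trans (ltnW nM)).
  have -> : (2 ^ M.+1 = 32 * m)%N by rewrite -(expnD 2 5); congr (2 ^ _)%N; lia.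
  have -> : (2 ^ 13 = 64 * 32 * 4)%N by [].
  have : (M.+1 * M.+2 <= 4 * (M * M))%N by nia.
  by move/(leq_mul (leqnn (64 * 32 * m))%N); lia.
apply: le_trans (_ : (2 ^ 13 * (M * M) * m)%N%:R <= _ :> R).
  by rewrite ler_nat.
have M2 : (M%:R * M%:R : R) <= 2 ^+ 2 * l ^+ 2.
  rewrite -exprMn -expr2 lerXn2r ?nnegrE ?ler0n ?mulr_ge0 ?(ltW l_gt0) //.
  by rewrite mulrC -ler_pdivrMr.
have hM : 2 ^+ 13 * (M%:R * M%:R) <= l ^+ 2 * l `^ eps.
  apply: le_trans (ler_wpM2l _ M2) _; first by rewrite exprn_ge0.
  by rewrite mulrA -exprD mulrC ler_wpM2l // exprn_ge0 // ltW.
rewrite !natrM natrX mulrC [leRHS]mulrAC [leRHS]mulrC ler_wpM2l // ?ler0n //.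
apply: (le_trans hM); rewrite ler_peMl ?ler1n // mulr_ge0 ?powR_ge0 //.
by rewrite exprn_ge0 // ltW.
Qed.

Theorem proposition7 (R : realType) (w : Omega) (hw : (Omega0 `|` Omega1) w)
    (eps : R) (heps : 0 < eps) :
  growth_preceq (fun n : nat => expR (n%:R / (ln n%:R) `^ (2 + eps)))
    (fun n : nat => (overgroup_growth w n)%:R).
Proof.
have [r Sr nr] : exists2 r, overgroup_gens w (spinal r) & ~ ev_const r.
  apply: not_ev_const_gen => w2; case: hw => [w0|]; last by apply; right.
  have [i [N wi]] := w2; have [n Nn wn] := w0 (i + 1) N.
  have := wi n Nn; rewrite wn => /eqP.
  by rewrite addrC -subr_eq0 addrK oner_eq0.
exists 1, 1%N; split => //; near=> n.
have n0 : (64 * 4 * 5 * 2 ^ 4 <= n)%N by near: n; exact: nbhs_infty_ge.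
have [M [M4 Mn nM]] := scale_exists n0.
have leps : 2 ^+ 15 <= (ln (n%:R : R)) `^ eps.
  (* Chosen so that ln n >= c gives (ln n)^eps >= 2^15. *)
  pose c : R := (2 ^+ 15) `^ eps^-1.
  have cn : expR c <= n%:R by near: n; exact: nbhs_infty_ger.
  have -> : 2 ^+ 15 = c `^ eps.
    by rewrite -powRrM mulVf ?powRr1 ?exprn_ge0 ?lt0r_neq0.
  have cln : c <= ln n%:R.
    rewrite -[leLHS]expRK ler_ln ?posrE ?expR_gt0 //.
    exact: lt_le_trans (expR_gt0 c) cn.
  have c0 : 0 <= c by exact: powR_ge0.
  by apply: ge0_ler_powR; rewrite ?nnegrE ?(ltW heps) ?(le_trans c0).
rewrite mul1r mul1n.
apply: le_trans (_ : (2 ^ (6 * 2 ^ (M - 4)))%:R <= _); last first.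
  by rewrite ler_nat; apply: overgroup_growth_ge Sr nr M4 Mn.
(* With m = 2^(M-4), exp(3 m) <= 4^(3 m) = 2^(6 m). *)
rewrite -[6%N]/(2 * 3)%N -mulnA; apply: expR_le_pow2.
exact: div_ln_powR_le nM leps.
Unshelve. all: by end_near.
Qed.
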